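(* Let $V\in C^3(\mathbb{R}^3)$ satisfy (U) or (U'), and fix $\varepsilon>0$. Let $(r(t),u(t))$, $t\ge0$, be a global solution of the effective equation $\dot r=u$, $m(u)\dot u=-\nabla V(r)+\varepsilon a(u)\ddot u+\varepsilon b(u,\dot u)$ such that $\sup_{t\ge0}|u(t)|\le\bar u(\varepsilon)<1$ and $\sup_{t\ge0}|\dot u(t)|\le c(\varepsilon)$ for some constants $\bar u(\varepsilon)$, $c(\varepsilon)$. Then $\dot u(t)\to0$, $\ddot u(t)\to0$ and $\nabla V(r(t))\to0$ as $t\to\infty$.
   Context: (U): $\inf V>-\infty$ and $\sup_q(|V|+|\nabla V|+|\nabla^2V|+|\nabla^3V|)<\infty$. (U'): $V(q)\to\infty$ as $|q|\to\infty$. $\rho\in C_0^\infty(\mathbb{R}^3)$ radial, $\mathsf e=\int\rho\neq0$, $\hat\rho(k)=(2\pi)^{-3/2}\int\rho e^{-ik\cdot x}$. For $|u|<1$: $\gamma=(1-|u|^2)^{-1/2}$, $m_0(u)w=\gamma w+\gamma^3(u\cdot w)u$, $m_e=\frac13\int|\hat\rho|^2|k|^{-2}dk$, $\varphi(s)=\frac{1}{2s^2(1-s^2)}-\frac{1}{4s^3}\log\frac{1+s}{1-s}$, $m_f(u)w=3m_e(\varphi(|u|)w+|u|^{-1}\varphi'(|u|)(u\cdot w)u)$, $m=m_0+m_f$, $a(u)w=\frac{\mathsf e^2}{12\pi}[\gamma^4w+4\gamma^6(u\cdot w)u]$, $b(u,w)=\frac{\mathsf e^2}{4\pi}[2\gamma^6(u\cdot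 w)w+\gamma^6|w|^2u+6\gamma^8(u\cdot w)^2u]$. *)

(* Defs.v *)
From HB Require Import structures.
From mathcomp Require Import all_boot all_order all_algebra.
From mathcomp Require Import all_classical all_reals all_analysis.
Set Implicit Arguments. Unset Strict Implicit. Unset Printing Implicit Defensive.
Import Order.TTheory GRing.Theory Num.Theory.
Import numFieldNormedType.Exports.
Local Open Scope classical_set_scope.
Local Open Scope ring_scope.

Section Defs.
Variable R : realType.
Local Notation vec := 'rV[R]_3.

Definition ef_dot (u w : vec) : R := \sum_(i < 3) u ord0 i * w ord0 i.
Definition ef_enorm (u : vec) : R := Num.sqrt (ef_dot u u).

Definition ebasis (i : 'I_3) : vec := delta_mx 0 i.

Definition pd (i : 'I_3) (f : vec -> R) : vec -> R := fun q => 'D_(ebasis i) f q.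

Definition iterpd (s : seq 'I_3) (f : vec -> R) : vec -> R := foldr pd f s.

Definition Ck (k : nat) (f : vec -> R) : Prop :=
  forall s : seq 'I_3, (size s <= k)%N ->
    continuous (iterpd s f) /\
    ((size s < k)%N -> forall (i : 'I_3) (q : vec), derivable (iterpd s f) q (ebasis i)).

Definition Cinf (f : vec -> R) : Prop := forall k, Ck k f.

Definition grad (f : vec -> R) (q : vec) : vec := \row_i pd i f q.

Definition condU (V : vec -> R) : Prop :=
  (exists c : R, forall q, c <= V q) /\
  (exists M : R, forall q (s : seq 'I_3), (size s <= 3)%N -> `|iterpd s V q| <= M).

Definition condU' (V : vec -> R) : Prop :=
  forall M : R, exists R0 : R, forall q, R0 < ef_enorm q -> M < V q.

Definition compact_support (f : vec -> R) : Prop :=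
  exists R0 : R, forall x, R0 < ef_enorm x -> f x = 0.
Definition radial (f : vec -> R) : Prop :=
  forall x y, ef_enorm x = ef_enorm y -> f x = f y.

Definition vec3 (p : (R * R) * R) : vec :=
  \row_(i < 3) [:: p.1.1; p.1.2; p.2]`_i.
Definition leb3 := ((@lebesgue_measure R \x @lebesgue_measure R) \x @lebesgue_measure R)%E.

Definition int3 (f : vec -> R) : R := fine (\int[leb3]_p (f (vec3 p))%:E)%E.

Definition ef_charge (rho : vec -> R) : R := int3 rho.

(* |hat rho(k)|^2, hat rho(k) = (2pi)^{-3/2} int rho(x) e^{-i k.x} dx,
   written via its real part and imaginary part *)
Definition rhohat_sq (rho : vec -> R) (k : vec) : R :=
  (2 * pi) ^- 3 *
  ((int3 (fun x => rho x * cos (ef_dot k x))) ^+ 2 +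
   (int3 (fun x => - (rho x * sin (ef_dot k x)))) ^+ 2).

Definition m_e (rho : vec -> R) : R :=
  3^-1 * int3 (fun k => rhohat_sq rho k / (ef_enorm k ^+ 2)).

Definition ef_gamma (u : vec) : R := (Num.sqrt (1 - ef_enorm u ^+ 2))^-1.

(* ef_phi, extended by continuity at s = 0 (ef_phi(0+) = 1/3) *)
Definition ef_phi (s : R) : R :=
  if s == 0 then 3^-1
  else (2 * s ^+ 2 * (1 - s ^+ 2))^-1 - (4 * s ^+ 3)^-1 * ln ((1 + s) / (1 - s)).

Definition m0 (u w : vec) : vec :=
  ef_gamma u *: w + (ef_gamma u ^+ 3 * ef_dot u w) *: u.

Definition mf (rho : vec -> R) (u w : vec) : vec :=
  (3 * m_e rho) *: (ef_phi (ef_enorm u) *: w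
     + ((ef_enorm u)^-1 * (derive1 ef_phi (ef_enorm u)) * ef_dot u w) *: u).

Definition ef_mass (rho : vec -> R) (u w : vec) : vec := m0 u w + mf rho u w.

Definition amat (rho : vec -> R) (u w : vec) : vec :=
  (ef_charge rho ^+ 2 / (12 * pi)) *:
    (ef_gamma u ^+ 4 *: w + (4 * ef_gamma u ^+ 6 * ef_dot u w) *: u).

Definition bvec (rho : vec -> R) (u w : vec) : vec :=
  (ef_charge rho ^+ 2 / (4 * pi)) *:
    ((2 * ef_gamma u ^+ 6 * ef_dot u w) *: w + (ef_gamma u ^+ 6 * ef_enorm w ^+ 2) *: u
     + (6 * ef_gamma u ^+ 8 * ef_dot u w ^+ 2) *: u).

End Defs.

(* Main.v *)
Require Import Defs.
From HB Require Import structures.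
From mathcomp Require Import all_boot all_order all_algebra.
From mathcomp Require Import all_classical all_reals all_analysis.
From mathcomp Require Import ring lra.
Import Order.TTheory GRing.Theory Num.Theory.
Import numFieldNormedType.Exports.
Local Open Scope classical_set_scope.
Local Open Scope ring_scope.

(** Along a solution, the energy [gamma + K_f(u) + V(r)] diminished by the Schott
term [eps u.a(u)u'] has derivative [- eps k (gamma^6 |u'|^2 + 6 gamma^8 (u.u')^2)],
where [k = e^2 / (12 pi)] and [K_f] is a primitive of [u.m_f(u)u'].  Since it is
bounded below it converges; it also keeps [r] in a bounded set under (U'), so in
both cases the derivatives of [V] are bounded along the trajectory and, [a(u)]
being coercive, so is [u'']. Barbalat's lemma then gives [u' -> 0].  Next,
[eps a(u)u'] tends to [0] and its derivative is [grad V(r) + o(1)] with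
[grad V(r)] Lipschitz, so the same lemma gives [grad V(r) -> 0], and the equation
of motion yields [a(u)u'' -> 0], hence [u'' -> 0]. *)

(** * Boundedness and decay at infinity *)

Section Asymptotics.
Context {R : realType}.
Implicit Types (f g : R -> R) (t : R).

Definition bdd f := exists M, forall t, 1 <= t -> `|f t| <= M.

Definition vanishing f := f t @[t --> +oo] --> (0 : R).

Lemma bdd_cst (k : R) : bdd (fun=> k).
Proof. by exists `|k|. Qed.

Lemma bddN {f} : bdd f -> bdd (fun t => - f t).
Proof. by move=> [M fM]; exists M => t /fM; rewrite normrN. Qed.

Lemma bddD {f g} : bdd f -> bdd g -> bdd (fun t => f t + g t).
Proof.
move=> [M fM] [N gN]; exists (M + N) => t t1.
by rewrite (le_trans (ler_normD _ _))// lerD ?fM ?gN.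
Qed.

Lemma bddM {f g} : bdd f -> bdd g -> bdd (fun t => f t * g t).
Proof.
move=> [M fM] [N gN]; exists (M * N) => t t1.
by rewrite normrM ler_pM ?fM ?gN.
Qed.

Lemma bddX {f} n : bdd f -> bdd (fun t => f t ^+ n).
Proof.
move=> [M fM]; exists (M ^+ n) => t t1.
by rewrite normrX lerXn2r ?nnegrE ?fM// (le_trans _ (fM _ t1)).
Qed.

Lemma bdd_le {f} g : (forall t, 1 <= t -> `|f t| <= `|g t|) -> bdd g -> bdd f.
Proof. by move=> fg [M gM]; exists M => t t1; rewrite (le_trans (fg _ t1))// gM. Qed.

Lemma bdd_sqr {f} : bdd (fun t => f t ^+ 2) -> bdd f.
Proof.
move=> [M fM]; exists (1 + M) => t t1; have := fM _ t1.
rewrite normrX; have := sqr_ge0 (`|f t| - 1); rewrite sqrrB1 => A B.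
by have := normr_ge0 (f t); lra.
Qed.

Lemma vanishing_eq f g : (forall t, 1 <= t -> f t = g t) ->
  vanishing g -> vanishing f.
Proof.
move=> fg; apply: cvg_trans; apply: near_eq_cvg; near=> t.
by rewrite fg//; near: t; exact: nbhs_pinfty_ge (num_real _).
Unshelve. all: by end_near. Qed.

Lemma vanishingP {f} :
  vanishing f <-> forall e, 0 < e -> \forall t \near +oo, `|f t| <= e.
Proof. exact: cvgr0Pnorm_le. Qed.

Lemma vanishing_le {f} g : (forall t, 1 <= t -> `|f t| <= `|g t|) ->
  vanishing g -> vanishing f.
Proof.
move=> fg /vanishingP v0; apply/vanishingP => e e0; near=> t.
have t1 : 1 <= t by near: t; exact: nbhs_pinfty_ge (num_real _).
by rewrite (le_trans (fg _ t1))//; near: t; exact: v0.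
Unshelve. all: by end_near. Qed.

Lemma vanishingN {f} : vanishing f -> vanishing (fun t => - f t).
Proof. by move=> f0; rewrite /vanishing -oppr0; exact: cvgN. Qed.

Lemma vanishingD {f g} :
  vanishing f -> vanishing g -> vanishing (fun t => f t + g t).
Proof. by move=> f0 g0; rewrite /vanishing -(addr0 0); exact: cvgD. Qed.

Lemma bdd_vanishingM {f g} :
  bdd f -> vanishing g -> vanishing (fun t => f t * g t).
Proof.
move=> [M fM] g0; apply: (@vanishing_le _ (fun t => M * g t)).
  by move=> t t1; rewrite !normrM ler_wpM2r// (le_trans (fM _ t1))// ler_norm.
by rewrite /vanishing -(mulr0 M); apply: cvgM => //; exact: cvg_cst.
Qed.

Lemma vanishing_bddM {f g} :
  vanishing f -> bdd g -> vanishing (fun t => f t * g t).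
Proof.
by move=> f0 gb; apply: (vanishing_eq _ _ _ (bdd_vanishingM gb f0)) => t _; rewrite mulrC.
Qed.

Lemma vanishing_sqr {f} : vanishing (fun t => f t ^+ 2) -> vanishing f.
Proof.
move=> /vanishingP f0; apply/vanishingP => e e0.
have := f0 _ (exprn_gt0 2 e0); apply: filterS => t.
by rewrite normrX ler_sqr ?nnegrE// ltW.
Qed.

Lemma nonincreasing_cvg f m : (forall s t, 1 <= s -> s <= t -> f t <= f s) ->
  (forall t, 1 <= t -> m <= f t) -> cvg (f t @[t --> +oo]).
Proof.
move=> fd fm; pose g t := - f (Num.max 1 t).
have gc : g t @[t --> +oo] --> sup (range g).
  apply: nondecreasing_cvgr.
    move=> s t st; rewrite lerN2; apply: fd; first by rewrite le_max lexx.
    by rewrite ge_max le_max lexx/= le_max st orbT.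
  by exists (- m) => _ [t _ <-]; rewrite lerN2 fm// le_max lexx.
apply/cvg_ex; exists (- sup (range g)); apply: cvg_trans (cvgN gc).
apply: near_eq_cvg; near=> t.
by rewrite /g opprK max_r//; near: t; exact: nbhs_pinfty_ge (num_real _).
Unshelve. all: by end_near. Qed.

Lemma MVT_derive f df a b : a < b ->
  (forall t, a <= t <= b -> is_derive t 1 f (df t)) ->
  exists2 c, a <= c <= b & f b - f a = df c * (b - a).
Proof.
move=> ab fdf.
have [x||c cab ->] := @MVT R f df a b ab.
- by rewrite in_itv/= => /andP[ax xb]; apply: fdf; rewrite !ltW.
- apply: derivable_within_continuous => x; rewrite in_itv/= => /fdf.
  by move=> [].
by exists c => //; move: cab; rewrite in_itv/= => /andP[/ltW-> /ltW->].
Qed.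

(* If [G] exceeds [2e] at a late time, the Lipschitz bound keeps it above [e]
   on a window of fixed length, over which [P] then grows by a fixed amount:
   this contradicts the convergence of [P]. *)
Lemma barbalat (P G dP dG : R -> R) :
  (forall t, 1 <= t -> is_derive t 1 P (dP t)) ->
  (forall t, 1 <= t -> is_derive t 1 G (dG t)) ->
  bdd dG -> cvg (P t @[t --> +oo]) ->
  (forall d : R, 0 < d -> \forall t \near +oo, G t - d <= dP t) ->
  forall e : R, 0 < e -> \forall t \near +oo, G t <= e.
Proof.
move=> PdP GdG [L0 dGL0] cP GdP e e0.
pose L := `|L0| + 1; have L_gt0 : 0 < L by rewrite ltr_wpDl.
have dGL t : 1 <= t -> `|dG t| <= L.
  move=> t1; rewrite (le_trans (dGL0 _ t1))// (le_trans (ler_norm _))//.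
  by rewrite lerDl.
pose h := e / (4 * L); have h0 : 0 < h by rewrite divr_gt0// mulr_gt0.
have hL : h * L = e / 4 by rewrite /h; field; rewrite gt_eqF.
have eta0 : 0 < h * e / 8 by rewrite divr_gt0// mulr_gt0.
have e40 : 0 < e / 4 by rewrite divr_gt0.
have [T1 [T1r GP]] := GdP _ e40.
move/cvg_ex: cP => [l /cvgrPdist_le/(_ _ eta0) [T2 [T2r Pl]]].
near=> t; rewrite leNgt; apply/negP => et.
have t1 : 1 <= t by near: t; exact: nbhs_pinfty_ge (num_real _).
have tT1 : T1 < t by near: t; exact: nbhs_pinfty_gt (num_real _).
have tT2 : T2 < t by near: t; exact: nbhs_pinfty_gt (num_real _).
have tth : t < t + h by rewrite ltrDl.
have Glb s : t <= s <= t + h -> e / 2 + e / 4 <= G s.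
  move=> /andP[]; rewrite le_eqVlt => /predU1P[<- _|ts sth]; first lra.
  have [x /andP[tx _]|c /andP[tc cs] Gc] := @MVT_derive G dG t s ts.
    by apply: GdG; rewrite (le_trans t1).
  have : `|G s - G t| <= e / 4.
    rewrite Gc normrM -hL mulrC ler_pM//.
      by rewrite ger0_norm; lra.
    by rewrite dGL// (le_trans t1).
  by rewrite ler_norml => /andP[]; lra.
have [x /andP[tx _]|c /andP[tc cs] Pc] := @MVT_derive P dP t (t + h) tth.
  by apply: PdP; rewrite (le_trans t1).
have dPc : e / 2 <= dP c.
  have := GP c (lt_le_trans tT1 tc); have := Glb c; rewrite tc cs => /(_ isT).
  by lra.
have := Pl _ tT2; have := Pl _ (lt_trans tT2 tth).
rewrite !ler_norml => /andP[A _] /andP[_ B].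
have : h * (e / 2) <= P (t + h) - P t.
  by rewrite Pc [t + h - t]addrC addKr mulrC ler_pM2r.
by move: A B eta0; lra.
Unshelve. all: by end_near. Qed.

End Asymptotics.

Section PointwiseDerive.
Context {R : realType}.
Implicit Types (f g : R -> R) (t : R).

Lemma is_derive_addf {f g t df dg} :
  is_derive t 1 f df -> is_derive t 1 g dg ->
  is_derive t 1 (fun x => f x + g x) (df + dg).
Proof. exact: is_deriveD. Qed.

Lemma is_derive_oppf {f t df} :
  is_derive t 1 f df -> is_derive t 1 (fun x => - f x) (- df).
Proof. exact: is_deriveN. Qed.

Lemma is_derive_mulf {f g t df dg} :
  is_derive t 1 f df -> is_derive t 1 g dg ->
  is_derive t 1 (fun x => f x * g x) (f t * dg + g t * df).
Proof. exact: is_deriveM. Qed.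

Lemma is_derive_expf {f t df} n :
  is_derive t 1 f df ->
  is_derive t 1 (fun x => f x ^+ n) (n%:R * f t ^+ n.-1 * df).
Proof. by move=> fdf; rewrite -[X in is_derive _ _ X]exprfctE; exact: is_deriveX. Qed.

Lemma is_derive_invf {f t df} : f t != 0 ->
  is_derive t 1 f df -> is_derive t 1 (fun x => (f x)^-1) (- (f t) ^- 2 * df).
Proof. exact: is_deriveV. Qed.

Lemma is_derive_compf f {g t df dg} :
  is_derive t 1 g dg -> is_derive (g t) 1 f df ->
  is_derive t 1 (fun x => f (g x)) (df * dg).
Proof. by move=> gdg fdf; exact: is_derive1_comp. Qed.

Lemma is_derive_cvg {V : normedModType R} {r : R -> V} {t dr} : is_derive t 1 r dr ->
  h^-1 *: (r (h + t) - r t) @[h --> 0^'] --> dr.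
Proof.
move=> [/cvgP rt <-].
have E : (fun h => h^-1 *: (r (h + t) - r t)) =
    (fun h => h^-1 *: ((r \o shift t) (h *: (1 : R)) - r t)).
  by apply/funext => h /=; rewrite [h *: 1]mulr1.
by rewrite E /derive; exact: rt.
Qed.

Lemma is_derive_dominated {f t} g (C : R) : f t = 0 -> g t = 0 ->
  (\forall s \near t, `|f s| <= C * `|g s|) ->
  is_derive t 1 g 0 -> is_derive t 1 f 0.
Proof.
move=> f0 g0 [d /= d0 fg] /is_derive_cvg dg.
have cv : h^-1 *: ((f \o shift t) (h *: (1 : R)) - f t)
    @[h --> 0^'] --> (0 : R).
  have /cvgr0Pnorm_le dgC : C * (h^-1 *: (g (h + t) - g t)) @[h --> 0^'] --> (0 : R).
    have := cvgM (cvg_cst C) dg; rewrite mulr0; exact.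
  apply/cvgr0Pnorm_le => e e0; near=> h.
  have hd : `|h| < d by near: h; exact: dnbhs0_lt.
  have := fg (h + t); rewrite /ball_/= distrC addrK => /(_ hd) fgh.
  have dge : `|C * (h^-1 *: (g (h + t) - g t))| <= e by near: h; exact: dgC.
  apply: le_trans dge; rewrite [h *: 1]mulr1 f0 g0 !subr0.
  by rewrite mulrCA !normrM ler_wpM2l// (le_trans fgh)// ler_wpM2r// ler_norm.
by apply: DeriveDef; [apply: cvgP cv | exact: cvg_lim].
Unshelve. all: by end_near. Qed.

End PointwiseDerive.

(* Instance resolution would choose a derivative stated with [*:], which [ring]
   and [field] do not normalize; hence [notypeclasses]. *)
Ltac pointwise_derive :=
  simple notypeclasses refine (@is_derive_eq _ _ _ _ _ _ _ _ _ _);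
  [shelve | repeat first
    [ eassumption
    | notypeclasses refine (is_derive_cst _ _ _)
    | notypeclasses refine (is_derive_id _ _)
    | notypeclasses refine (is_derive_oppf _)
    | notypeclasses refine (is_derive_addf _ _)
    | notypeclasses refine (is_derive_expf _ _)
    | notypeclasses refine (is_derive_invf _ _)
    | notypeclasses refine (is_derive_mulf _ _) ]
  | rewrite /= ].

Ltac bdd_rules := solve [repeat first
  [ assumption | apply: bdd_cst | apply: bddN | apply: bddD | apply: bddX
  | apply: bddM ]].

Ltac vanishing_rules := first
  [ assumption
  | apply: vanishingN; vanishing_rules
  | apply: vanishingD; vanishing_rules
  | apply: bdd_vanishingM; [bdd_rules | vanishing_rules]
  | apply: vanishing_bddM; [vanishing_rules | bdd_rules] ].

(** * The form factor of the field mass *)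

Section Phi.
Context {R : realType}.
Implicit Types (s b : R).

(* [2 s^3 phi(s)]: its derivative [2 s^2 / (1 - s^2)^2] makes the cancellation of
   the singular terms of [phi] at [0] explicit. *)
Definition phi_num s : R := s / (1 - s ^+ 2) - ln ((1 + s) / (1 - s)) / 2.

Lemma is_derive_phi_num s : 0 <= s < 1 ->
  is_derive s 1 phi_num (2 * s ^+ 2 / (1 - s ^+ 2) ^+ 2).
Proof.
move=> /andP[s0 s1].
have m0 : 1 - s != 0 by lra.
have p0 : 1 + s != 0 by lra.
have q0 : 1 - s ^+ 2 != 0 by rewrite gt_eqF// subr_gt0 exprn_ilt1.
have pos : 0 < (1 + s) / (1 - s) by rewrite divr_gt0; lra.
have d1 : is_derive s 1 (fun x : R => (1 + x) / (1 - x)) (2 / (1 - s) ^+ 2).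
  by pointwise_derive; field.
have d2 := is_derive_compf (@ln R) d1 (is_derive1_ln pos).
have d3 : is_derive s 1 (fun x : R => x / (1 - x ^+ 2)) ((1 + s ^+ 2) / (1 - s ^+ 2) ^+ 2).
  pointwise_derive.
  by field.
pointwise_derive.
field.
by rewrite q0 m0 p0.
Qed.

Lemma phi_num0 : phi_num 0 = 0.
Proof. by rewrite /phi_num addr0 subr0 divr1 ln1 !mul0r subrr. Qed.

Lemma ef_phiE s : 0 < s < 1 -> ef_phi s = phi_num s / (2 * s ^+ 3).
Proof.
move=> /andP[s0 s1]; rewrite /ef_phi gt_eqF// /phi_num.
have q0 : 1 - s ^+ 2 != 0 by rewrite gt_eqF// subr_gt0 exprn_ilt1// ltW.
have s0' : s != 0 by rewrite gt_eqF.
by field; rewrite q0 s0'.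
Qed.

Lemma phi_num_bounds s b : 0 <= s <= b -> b < 1 ->
  0 <= phi_num s <= 2 * s ^+ 3 / (1 - b ^+ 2) ^+ 2.
Proof.
move=> /andP[]; rewrite le_eqVlt => /predU1P[<- b0 b1|s0 sb b1].
  by rewrite phi_num0 expr0n/= mulr0 mul0r lexx.
have b0 : 0 <= b by lra.
have [t /andP[t0 ts]|c /andP[c0 cs]] :=
  MVT_derive phi_num (fun t => 2 * t ^+ 2 / (1 - t ^+ 2) ^+ 2) _ _ s0.
  by apply: is_derive_phi_num; rewrite t0 (le_lt_trans ts)// (le_lt_trans sb).
rewrite phi_num0 !subr0 => ->.
have qb : 0 < 1 - b ^+ 2 by rewrite subr_gt0 exprn_ilt1.
have cb : c ^+ 2 <= b ^+ 2 by rewrite lerXn2r ?nnegrE// (le_trans cs).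
have cs2 : c ^+ 2 <= s ^+ 2 by rewrite lerXn2r ?nnegrE// ltW.
apply/andP; split.
  by rewrite mulr_ge0 ?(ltW s0)// divr_ge0 ?sqr_ge0// mulr_ge0 ?sqr_ge0.
rewrite [s ^+ 3]exprSr [2 * (_ * s)]mulrA [leRHS]mulrAC ler_wpM2r ?(ltW s0)//.
rewrite ler_pM ?mulr_ge0 ?invr_ge0 ?sqr_ge0 ?ler_wpM2l//.
by rewrite lef_pV2 ?posrE ?exprn_gt0// ?lerXn2r ?nnegrE; lra.
Qed.

Lemma ef_phi_bounds s b : 0 <= s <= b -> b < 1 ->
  0 <= ef_phi s <= (1 - b ^+ 2) ^- 2.
Proof.
move=> /andP[s0 sb] b1; have b0 := le_trans s0 sb.
have qb : 0 < 1 - b ^+ 2 by rewrite subr_gt0 exprn_ilt1.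
move: s0; rewrite le_eqVlt => /predU1P[<-|s0].
  rewrite /ef_phi eqxx invr_ge0 ler0n/=.
  apply: (@le_trans _ _ 1); first by rewrite invf_le1 ?ler1n.
  rewrite -[leLHS]invr1 lef_pV2 ?posrE ?exprn_gt0// exprn_ile1 ?(ltW qb)//.
  by rewrite lerBlDr lerDl sqr_ge0.
have s3 : 0 < 2 * s ^+ 3 by rewrite mulr_gt0 ?exprn_gt0.
have /andP[h0 h1] : 0 <= phi_num s <= 2 * s ^+ 3 / (1 - b ^+ 2) ^+ 2.
  by apply: phi_num_bounds; rewrite ?(ltW s0).
rewrite ef_phiE ?s0 ?(le_lt_trans sb)//= divr_ge0 ?(ltW s3)//=.
by rewrite ler_pdivrMr// mulrC.
Qed.

Lemma is_derive_ef_phi s : 0 < s < 1 ->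
  is_derive s 1 (@ef_phi R) (((1 - s ^+ 2) ^- 2 - 3 * ef_phi s) / s).
Proof.
move=> s01; have /andP[s0 s1] := s01.
have q0 : 1 - s ^+ 2 != 0 by rewrite gt_eqF// subr_gt0 exprn_ilt1// ltW.
have s0' : s != 0 by rewrite gt_eqF.
have s30 : 2 * s ^+ 3 != 0 by rewrite mulf_neq0// expf_neq0.
apply: (@near_eq_is_derive _ _ _ (fun x => phi_num x / (2 * x ^+ 3))).
- near=> x; rewrite ef_phiE//; apply/andP; split; near: x.
  + exact: lt_nbhsr.
  + exact: lt_nbhsl.
- have ds : 0 <= s < 1 by rewrite (ltW s0).
  have dp := is_derive_phi_num _ ds.
  pointwise_derive.
  rewrite ef_phiE//=; field.
  by rewrite q0 s0'.
Unshelve. all: by end_near. Qed.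

End Phi.

(** * Functions of class C^1 on R^3 *)

Section ChainRule.
Context {R : realType}.
Notation vec := 'rV[R]_3.
Implicit Types (f : vec -> R) (q d : vec) (s t : R).

Lemma sum3 (F : 'I_3 -> R) : \sum_(i < 3) F i = F 0 + F 1 + F 2.
Proof.
rewrite !big_ord_recl big_ord0 addr0 addrA.
by congr (F _ + F _ + F _); apply/val_inj.
Qed.

Lemma is_derive_line f q i s : derivable f (q + s *: ebasis R i) (ebasis R i) ->
  is_derive s 1 (fun x => f (q + x *: ebasis R i)) (pd i f (q + s *: ebasis R i)).
Proof.
move=> df.
have E : (fun h => h^-1 *: (((fun x => f (q + x *: ebasis R i)) \o shift s) (h *: (1 : R))
      - f (q + s *: ebasis R i))) =
    (fun h => h^-1 *: ((f \o shift (q + s *: ebasis R i)) (h *: ebasis R i)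
      - f (q + s *: ebasis R i))).
  apply/funext => h /=; congr (_ *: (f _ - _)).
  by rewrite [h *: 1]mulr1 scalerDl addrCA.
by apply: DeriveDef; [rewrite /derivable E | rewrite /pd /derive E].
Qed.

Lemma line_increment f q i s : (forall x, derivable f x (ebasis R i)) ->
  exists2 c, `|c| <= `|s| &
    f (q + s *: ebasis R i) - f q = pd i f (q + c *: ebasis R i) * s.
Proof.
move=> df; have dg x := is_derive_line f q i x (df _).
have [s0|s0|->] := ltgtP s 0.
- have [c /andP[sc c0]] :=
    MVT_derive (fun x => f (q + x *: ebasis R i)) _ _ _ s0 (fun x _ => dg x).
  rewrite scale0r addr0 sub0r mulrN => E.
  exists c; first by rewrite !ler0_norm ?lerN2// ltW.
  by rewrite -opprB E opprK.
- have [c /andP[c0 cs]] :=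
    MVT_derive (fun x => f (q + x *: ebasis R i)) _ _ _ s0 (fun x _ => dg x).
  rewrite scale0r addr0 subr0 => E.
  by exists c => //; rewrite !ger0_norm // ltW.
- by exists 0; rewrite ?scale0r ?addr0 ?subrr ?mulr0.
Qed.

Lemma norm_coord q i : `|q 0 i| <= `|q|.
Proof.
by rewrite [leRHS]/Num.Def.normr/= mx_normrE; exact: (le_bigmax _ _ (0, i)).
Qed.

Lemma norm_rowP q (M : R) : 0 <= M -> (forall i, `|q 0 i| <= M) -> `|q| <= M.
Proof.
move=> M0 qM; rewrite /Num.Def.normr/= mx_normrE (bigmax_le _ M0)//= => -[i j] _.
by rewrite ord1; exact: qM.
Qed.

Lemma row3_expand d :
  d = d 0 0 *: ebasis R 0 + d 0 1 *: ebasis R 1 + d 0 2 *: ebasis R 2.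
Proof.
rewrite [LHS]row_sum_delta !big_ord_recl big_ord0 addr0 addrA.
by congr (_ *: delta_mx _ _ + _ *: delta_mx _ _ + _ *: delta_mx _ _);
  try congr (d _ _); apply/val_inj.
Qed.

Lemma increment f q d : (forall i x, derivable f x (ebasis R i)) ->
  exists2 xi : 'I_3 -> vec, (forall i, `|xi i - q| <= `|d|) &
    f (q + d) - f q = \sum_(i < 3) pd i f (xi i) * d 0 i.
Proof.
move=> df.
have [c0 c0d E0] := line_increment f q 0 (d 0 0) (df 0).
have [c1 c1d E1] := line_increment f (q + d 0 0 *: ebasis R 0) 1 (d 0 1) (df 1).
have [c2 c2d E2] :=
  line_increment f (q + d 0 0 *: ebasis R 0 + d 0 1 *: ebasis R 1) 2 (d 0 2) (df 2).
exists (fun i => if i == 0 then q + c0 *: ebasis R 0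
  else if i == 1 then q + d 0 0 *: ebasis R 0 + c1 *: ebasis R 1
  else q + d 0 0 *: ebasis R 0 + d 0 1 *: ebasis R 1 + c2 *: ebasis R 2).
  have d0 := norm_coord d 0; have d1 := norm_coord d 1; have d2 := norm_coord d 2.
  have c0d' := le_trans c0d d0; have c1d' := le_trans c1d d1; have c2d' := le_trans c2d d2.
  move=> i; apply: norm_rowP => // j.
  case: i => -[|[|[|//]]] ? /=; case: j => -[|[|[|//]]] ? //=;
    rewrite /= !mxE /= ?mulr0 ?mulr1 ?addr0 ?add0r //.
  all: try by rewrite ?[_ + _ - _]addrAC subrr ?add0r ?normr0.
rewrite sum3 /= -E0 -E1 -E2 {1}(row3_expand d) !addrA; ring.
Qed.

Lemma is_derive_coord (r : R -> vec) t dr i :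
  is_derive t 1 r dr -> is_derive t 1 (fun s => r s 0 i) (dr 0 i).
Proof.
move=> [rt <-]; apply: DeriveDef; first by move/derivable_mxP: rt; exact.
by rewrite derive_mx// mxE.
Qed.

Lemma is_derive_gradient f (r : R -> vec) t dr :
  (forall i x, derivable f x (ebasis R i)) -> (forall i, continuous (pd i f)) ->
  is_derive t 1 r dr ->
  is_derive t 1 (fun s => f (r s)) (\sum_(i < 3) pd i f (r t) * dr 0 i).
Proof.
move=> df cf rdr.
have /choice[xi xiP] : forall h, exists x : 'I_3 -> vec,
    (forall i, `|x i - r t| <= `|r (h + t) - r t|) /\
    f (r (h + t)) - f (r t) = \sum_(i < 3) pd i f (x i) * (r (h + t) - r t) 0 i.
  move=> h; have [x xP] := increment f (r t) (r (h + t) - r t) df.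
  by rewrite [r t + _]addrC subrK => E; exists x.
have cvg_id0 : h @[h --> (0 : R)^'] --> (0 : R).
  exact: cvg_within_filter cvg_id.
have rc : (fun h => r (h + t) - r t) @ 0^' --> (0 : vec).
  rewrite -(scale0r dr); apply: cvg_trans (cvgZ cvg_id0 (is_derive_cvg rdr)).
  apply: near_eq_cvg; near=> h; rewrite scalerA mulfV ?scale1r//.
  by near: h; exact: nbhs_dnbhs_neq.
have xic i : (fun h => xi h i) @ 0^' --> r t.
  apply/cvgrPdist_le => e e0.
  have /cvgr0Pnorm_le/(_ e e0) := rc; apply: filterS => h.
  by move=> rh; rewrite distrC (le_trans ((xiP h).1 i)).
have cv : h^-1 *: (((fun s => f (r s)) \o shift t) (h *: (1 : R)) - f (r t))
    @[h --> 0^'] --> \sum_(i < 3) pd i f (r t) * dr 0 i.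
  have -> : (fun h => h^-1 *: (((fun s => f (r s)) \o shift t) (h *: (1 : R)) - f (r t))) =
     (fun h => \sum_(i < 3) pd i f (xi h i) * (h^-1 *: (r (h + t) 0 i - r t 0 i))).
    apply/funext => h /=; rewrite [h *: 1]mulr1 (xiP h).2 scaler_sumr.
    by apply: eq_bigr => i _; rewrite !mxE scalerAr.
  have cvi i : pd i f (xi h i) * (h^-1 *: (r (h + t) 0 i - r t 0 i)) @[h --> 0^']
      --> pd i f (r t) * dr 0 i.
    apply: cvgM; last exact: (is_derive_cvg (is_derive_coord _ _ _ _ rdr)).
    exact: (@cvg_comp _ _ _ (fun h => xi h i) (pd i f) _ _ _ (xic i) (cf i (r t))).
  by under eq_fun do rewrite sum3; rewrite sum3; apply: cvgD => //; exact: cvgD.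
by apply: DeriveDef; [apply/cvg_ex; eexists; exact: cv | exact: cvg_lim].
Unshelve. all: by end_near. Qed.

Lemma coord_le_enorm q i : `|q 0 i| <= ef_enorm q.
Proof.
rewrite -sqrtr_sqr /ef_enorm ler_wsqrtr// /ef_dot (bigD1 i)//= -expr2 lerDl.
by apply: sumr_ge0 => j _; rewrite -expr2 sqr_ge0.
Qed.

Lemma bounded_on_enorm_ball f (M : R) : continuous f ->
  exists B, forall q, ef_enorm q <= M -> `|f q| <= B.
Proof.
move=> cf; pose A : set vec := [set q | `|q| <= `|M|].
have cA : compact A.
  apply: bounded_closed_compact.
    by exists `|M|; split=> // x Mx q /= qA; rewrite (le_trans qA)// ltW.
  apply: (@closed_comp _ _ (fun q : vec => `|q|) [set x | x <= `|M|]); last exact: closed_le.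
  by move=> x _; exact: norm_continuous.
have [||c _ cP] := @EVT_max_rV R _ (fun q => `|f q|) A _ cA.
- by exists 0; rewrite /A/= normr0.
- apply: continuous_subspaceT => x; exact: (continuous_comp (cf x) (@norm_continuous _ _ (f x))).
exists `|f c| => q qM; apply: cP; rewrite inE /A/=.
apply: norm_rowP => // i; rewrite (le_trans (coord_le_enorm q i))//.
by rewrite (le_trans qM)// ler_norm.
Qed.
End ChainRule.

(** * Mass, radiation and kinetic energy *)

Section Lorentz.
Context {R : realType}.
Notation vec := 'rV[R]_3.
Implicit Types (v w df dg : vec) (t b : R).

Lemma ef_dotE v w : ef_dot v w = v 0 0 * w 0 0 + v 0 1 * w 0 1 + v 0 2 * w 0 2.
Proof. exact: sum3. Qed.

Lemma ef_dot_ge0 v : 0 <= ef_dot v v.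
Proof. by rewrite ef_dotE -!expr2 !addr_ge0 ?sqr_ge0. Qed.

Lemma enorm_sqr v : ef_enorm v ^+ 2 = ef_dot v v.
Proof. by rewrite sqr_sqrtr ?ef_dot_ge0. Qed.

Definition gamma_sq v : R := (1 - ef_dot v v)^-1.

Lemma gammaXM v n : ef_dot v v < 1 -> ef_gamma v ^+ (2 * n) = gamma_sq v ^+ n.
Proof.
move=> v1; rewrite exprM /ef_gamma enorm_sqr exprVn sqr_sqrtr//.
by rewrite subr_ge0 ltW.
Qed.

Lemma gamma_sq_ge1 v : ef_dot v v < 1 -> 1 <= gamma_sq v.
Proof.
move=> v1; rewrite /gamma_sq invf_ge1 ?subr_gt0//.
by rewrite lerBlDr lerDl ef_dot_ge0.
Qed.

Definition radiation_coef (rho : vec -> R) : R := ef_charge rho ^+ 2 / (12 * pi).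

Lemma radiation_coef_gt0 rho : ef_charge rho != 0 -> 0 < radiation_coef rho.
Proof.
by move=> e0; apply: divr_gt0; [rewrite exprn_even_gt0 | rewrite mulr_gt0 ?pi_gt0].
Qed.

Lemma amatE rho v w i : ef_dot v v < 1 -> amat rho v w 0 i =
  radiation_coef rho * (gamma_sq v ^+ 2 * w 0 i + 4 * gamma_sq v ^+ 3 * ef_dot v w * v 0 i).
Proof.
by move=> v1; rewrite /amat !mxE (gammaXM _ 2 v1) (gammaXM _ 3 v1).
Qed.

Lemma bvecE rho v w i : ef_dot v v < 1 -> bvec rho v w 0 i =
  3 * radiation_coef rho * (2 * gamma_sq v ^+ 3 * ef_dot v w * w 0 i
    + gamma_sq v ^+ 3 * ef_dot w w * v 0 i
    + 6 * gamma_sq v ^+ 4 * ef_dot v w ^+ 2 * v 0 i).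
Proof.
move=> v1; rewrite /bvec !mxE (gammaXM _ 3 v1) (gammaXM _ 4 v1) enorm_sqr.
have p0 : pi != 0 :> R by rewrite gt_eqF ?pi_gt0.
by rewrite /radiation_coef; move: (pi : R) p0 => p p0; field.
Qed.

Definition mf_coef v : R := (ef_enorm v)^-1 * derive1 (@ef_phi R) (ef_enorm v).

Lemma mass_coord rho v w i : ef_mass rho v w 0 i =
  ef_gamma v * w 0 i + ef_gamma v ^+ 3 * ef_dot v w * v 0 i
  + 3 * m_e rho * (ef_phi (ef_enorm v) * w 0 i + mf_coef v * ef_dot v w * v 0 i).
Proof. by rewrite /ef_mass /m0 /mf !mxE /mf_coef; ring. Qed.

Lemma enorm_eq0 v : (ef_enorm v == 0) = (v == 0).
Proof.
apply/eqP/eqP => [v0|->].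
  apply/rowP => i; rewrite mxE; apply/eqP; rewrite -normr_le0 -v0.
  exact: coord_le_enorm.
by rewrite /ef_enorm ef_dotE !mxE !mul0r !addr0 sqrtr0.
Qed.

Lemma enorm_ge0 v : 0 <= ef_enorm v.
Proof. exact: sqrtr_ge0. Qed.

Lemma enorm_lt1 v : (ef_enorm v < 1) = (ef_dot v v < 1).
Proof. by rewrite -enorm_sqr -[in RHS](expr1n _ 2) ltr_sqr ?nnegrE ?enorm_ge0. Qed.

Lemma mf_coefE v : v != 0 -> ef_dot v v < 1 ->
  mf_coef v = (gamma_sq v ^+ 2 - 3 * ef_phi (ef_enorm v)) / ef_enorm v ^+ 2.
Proof.
move=> v0 v1; have s0 : ef_enorm v != 0 by rewrite enorm_eq0.
have s01 : 0 < ef_enorm v < 1 by rewrite lt_def s0 enorm_ge0 enorm_lt1.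
have ds := is_derive_ef_phi _ s01.
have q0 : 1 - ef_enorm v ^+ 2 != 0 by rewrite enorm_sqr gt_eqF ?subr_gt0.
rewrite /mf_coef derive1E derive_val /gamma_sq -enorm_sqr; field.
by rewrite s0 q0.
Qed.

Lemma gamma_sq_le v b : ef_enorm v <= b -> b < 1 -> gamma_sq v <= (1 - b ^+ 2)^-1.
Proof.
move=> vb b1; have b0 : 0 <= b := le_trans (enorm_ge0 v) vb.
rewrite lef_pV2 ?posrE ?subr_gt0 ?exprn_ilt1// -?enorm_sqr.
  by rewrite lerD2l lerN2 lerXn2r ?nnegrE ?enorm_ge0.
by rewrite enorm_sqr -enorm_lt1 (le_lt_trans vb).
Qed.

Lemma mf_coef_bound v b i j : ef_enorm v <= b -> b < 1 ->
  `|mf_coef v * v 0 i * v 0 j| <= 4 * (1 - b ^+ 2) ^- 2.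
Proof.
move=> vb b1; have b0 : 0 <= b := le_trans (enorm_ge0 v) vb.
have B0 : 0 <= (1 - b ^+ 2) ^- 2 by rewrite invr_ge0 sqr_ge0.
have v1 : ef_dot v v < 1 by rewrite -enorm_lt1 (le_lt_trans vb).
have [->|v0] := eqVneq v 0; first by rewrite !mxE !mulr0 normr0 mulr_ge0.
have s0 : 0 < ef_enorm v by rewrite lt_def enorm_eq0 v0 enorm_ge0.
have /andP[p0 p1] : 0 <= ef_phi (ef_enorm v) <= (1 - b ^+ 2) ^- 2.
  by apply: ef_phi_bounds; rewrite ?enorm_ge0.
have x0 : 0 <= gamma_sq v by rewrite (le_trans _ (gamma_sq_ge1 _ v1)).
have x2 : gamma_sq v ^+ 2 <= (1 - b ^+ 2) ^- 2.
  rewrite -exprVn lerXn2r ?nnegrE ?gamma_sq_le// invr_ge0 subr_ge0.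
  by rewrite exprn_ile1 ?(ltW b1).
have -> : mf_coef v * v 0 i * v 0 j = (gamma_sq v ^+ 2 - 3 * ef_phi (ef_enorm v))
    * (v 0 i * v 0 j / ef_enorm v ^+ 2) by rewrite mf_coefE//; ring.
rewrite normrM.
apply: (@le_trans _ _ (4 * (1 - b ^+ 2) ^- 2 * 1)); last by rewrite mulr1.
apply: ler_pM => //.
  by rewrite ler_norml; have := sqr_ge0 (gamma_sq v); lra.
rewrite !normrM normfV normrX (gtr0_norm s0) ler_pdivrMr ?exprn_gt0// mul1r.
by rewrite expr2 ler_pM// coord_le_enorm.
Qed.

Definition kinetic (rho : vec -> R) v : R :=
  ef_gamma v + 3 * m_e rho *
    (2 * (ef_dot v v * ef_phi (ef_enorm v)) - gamma_sq v / 2).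

Lemma is_derive_dot (f g : R -> vec) t df dg : is_derive t 1 f df ->
  is_derive t 1 g dg ->
  is_derive t 1 (fun s => ef_dot (f s) (g s)) (ef_dot df (g t) + ef_dot (f t) dg).
Proof.
move=> fdf gdg.
have E : (fun s => ef_dot (f s) (g s)) =
    (fun s => f s 0 0 * g s 0 0 + f s 0 1 * g s 0 1 + f s 0 2 * g s 0 2).
  by apply/funext => s; rewrite ef_dotE.
have f0 := is_derive_coord _ _ _ 0 fdf; have f1 := is_derive_coord _ _ _ 1 fdf.
have f2 := is_derive_coord _ _ _ 2 fdf; have g0 := is_derive_coord _ _ _ 0 gdg.
have g1 := is_derive_coord _ _ _ 1 gdg; have g2 := is_derive_coord _ _ _ 2 gdg.
by rewrite E; pointwise_derive; rewrite !ef_dotE; ring.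
Qed.

Lemma ef_dotC v w : ef_dot v w = ef_dot w v.
Proof. by rewrite !ef_dotE; ring. Qed.

Lemma is_derive_gamma_sq (u : R -> vec) t w : is_derive t 1 u w ->
  ef_dot (u t) (u t) < 1 ->
  is_derive t 1 (fun s => gamma_sq (u s)) (2 * gamma_sq (u t) ^+ 2 * ef_dot (u t) w).
Proof.
move=> ut u1; have q0 : 1 - ef_dot (u t) (u t) != 0 by rewrite gt_eqF ?subr_gt0.
have dq := is_derive_dot _ _ _ _ _ ut ut.
rewrite /gamma_sq; pointwise_derive.
by rewrite (ef_dotC w); field.
Qed.

Lemma is_derive_gamma (u : R -> vec) t w : is_derive t 1 u w ->
  ef_dot (u t) (u t) < 1 ->
  is_derive t 1 (fun s => ef_gamma (u s)) (ef_gamma (u t) ^+ 3 * ef_dot (u t) w).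
Proof.
move=> ut u1; have q0 : 0 < 1 - ef_dot (u t) (u t) by rewrite subr_gt0.
have dq := is_derive_dot _ _ _ _ _ ut ut.
have E : (fun s => ef_gamma (u s)) = (fun s => (Num.sqrt (1 - ef_dot (u s) (u s)))^-1).
  by apply/funext => s; rewrite /ef_gamma enorm_sqr.
have dp : is_derive t 1 (fun s => 1 - ef_dot (u s) (u s)) (- (2 * ef_dot (u t) w)).
  by pointwise_derive; rewrite (ef_dotC w); ring.
have ds := is_derive_compf (@Num.sqrt R) dp (is_derive1_sqrt q0).
have s0 : Num.sqrt (1 - ef_dot (u t) (u t)) != 0 by rewrite gt_eqF ?sqrtr_gt0.
rewrite E; pointwise_derive.
by rewrite /ef_gamma enorm_sqr; field.
Qed.

Lemma is_derive_kinetic rho (u : R -> vec) t w b : is_derive t 1 u w ->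
  b < 1 -> (\forall s \near t, ef_enorm (u s) <= b) ->
  is_derive t 1 (fun s => kinetic rho (u s)) (ef_dot (u t) (ef_mass rho (u t) w)).
Proof.
move=> ut b1 ub; have utb : ef_enorm (u t) <= b := nbhs_singleton ub.
have u1 : ef_dot (u t) (u t) < 1 by rewrite -enorm_lt1 (le_lt_trans utb).
have dg := is_derive_gamma _ _ _ ut u1; have dx := is_derive_gamma_sq _ _ _ ut u1.
have dq := is_derive_dot _ _ _ _ _ ut ut.
pose m v : R := ef_dot v v * ef_phi (ef_enorm v).
have dm : is_derive t 1 (fun s => m (u s))
    (ef_phi (ef_enorm (u t)) * (2 * ef_dot (u t) w)
     + mf_coef (u t) * ef_dot (u t) w * ef_dot (u t) (u t)).
  have [u0|u0] := eqVneq (u t) 0.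
    have d0 y : ef_dot (u t) y = 0 by rewrite u0 ef_dotE !mxE !mul0r !addr0.
    rewrite !d0 !mulr0 addr0.
    (* [|u|] need not be differentiable here, but [m] is [O(|u|^2)]. *)
    apply: (is_derive_dominated (fun s => ef_dot (u s) (u s)) ((1 - b ^+ 2) ^- 2)).
    - by rewrite /m d0 mul0r.
    - by rewrite d0.
    - apply: filterS ub => s sb; rewrite /m normrM mulrC ler_wpM2r//.
      have /andP[p0 p1] : 0 <= ef_phi (ef_enorm (u s)) <= (1 - b ^+ 2) ^- 2.
        by apply: ef_phi_bounds; rewrite ?enorm_ge0.
      by rewrite ger0_norm.
    - by apply: is_derive_eq dq _; rewrite ef_dotC !d0 addr0.
  have s0 : 0 < ef_enorm (u t) by rewrite lt_def enorm_eq0 u0 enorm_ge0.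
  have q0 : 0 < ef_dot (u t) (u t) by rewrite -enorm_sqr exprn_gt0.
  have ds := is_derive_compf (@Num.sqrt R) dq (is_derive1_sqrt q0).
  have s01 : 0 < ef_enorm (u t) < 1 by rewrite s0 (le_lt_trans utb).
  have dphi := is_derive_compf (@ef_phi R) ds (is_derive_ef_phi _ s01).
  rewrite /m; pointwise_derive.
  rewrite mf_coefE// /gamma_sq -!enorm_sqr -/(ef_enorm (u t)) (ef_dotC w).
  have s0' : ef_enorm (u t) != 0 by rewrite gt_eqF.
  have q1 : 1 - ef_enorm (u t) ^+ 2 != 0 by rewrite enorm_sqr gt_eqF ?subr_gt0.
  rewrite sqrtr_sqr (ger0_norm (enorm_ge0 _)).
  by field; rewrite s0' q1.
have M : mf_coef (u t) * ef_dot (u t) w * ef_dot (u t) (u t) =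
    (gamma_sq (u t) ^+ 2 - 3 * ef_phi (ef_enorm (u t))) * ef_dot (u t) w.
  have [u0|u0] := eqVneq (u t) 0.
    by rewrite u0 !ef_dotE !mxE; ring.
  by rewrite mf_coefE// -enorm_sqr; field; rewrite enorm_eq0.
have G : ef_gamma (u t) ^+ 3 * (1 - ef_dot (u t) (u t)) = ef_gamma (u t).
  rewrite exprS (gammaXM _ 1 u1) /gamma_sq expr1 -mulrA mulVf ?mulr1//.
  by rewrite gt_eqF ?subr_gt0.
rewrite (_ : ef_dot (u t) (ef_mass rho (u t) w) =
    ef_gamma (u t) * ef_dot (u t) w + ef_gamma (u t) ^+ 3 * ef_dot (u t) w * ef_dot (u t) (u t)
    + 3 * m_e rho * (ef_phi (ef_enorm (u t)) * ef_dot (u t) w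
       + mf_coef (u t) * ef_dot (u t) w * ef_dot (u t) (u t))); last first.
  by rewrite ef_dotE !mass_coord !(ef_dotE (u t)); ring.
rewrite M in dm *.
have -> : ef_gamma (u t) * ef_dot (u t) w =
  ef_gamma (u t) ^+ 3 * (1 - ef_dot (u t) (u t)) * ef_dot (u t) w by rewrite G.
rewrite -[X in is_derive _ _ X]/(fun s =>
  ef_gamma (u s) + 3 * m_e rho * (2 * m (u s) - gamma_sq (u s) / 2)).
by pointwise_derive; field.
Qed.

Lemma amat_coercive rho v w : ef_charge rho != 0 -> ef_dot v v < 1 ->
  radiation_coef rho ^+ 2 * ef_dot w w <= ef_dot (amat rho v w) (amat rho v w).
Proof.
move=> e0 v1; have k0 := radiation_coef_gt0 _ e0; have x1 := gamma_sq_ge1 _ v1.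
set k := radiation_coef rho in k0 *; set x := gamma_sq v in x1.
have -> : ef_dot (amat rho v w) (amat rho v w) =
  k ^+ 2 * (x ^+ 4 * ef_dot w w + 8 * x ^+ 5 * ef_dot v w ^+ 2
    + 16 * x ^+ 6 * ef_dot v w ^+ 2 * ef_dot v v).
  by rewrite ef_dotE !amatE// -/k -/x !ef_dotE; ring.
rewrite ler_pM2l ?exprn_gt0//.
have x0 : 0 <= x by rewrite (le_trans _ x1).
have := ef_dot_ge0 w; have := ef_dot_ge0 v; have := sqr_ge0 (ef_dot v w) => d0 v0 w0.
have x5 : 0 <= x ^+ 5 * ef_dot v w ^+ 2 by apply: mulr_ge0 => //; exact: exprn_ge0.
have x6 : 0 <= x ^+ 6 * ef_dot v w ^+ 2 * ef_dot v v.
  by apply: mulr_ge0 => //; apply: mulr_ge0 => //; exact: exprn_ge0.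
have : ef_dot w w <= x ^+ 4 * ef_dot w w by rewrite ler_peMl// exprn_ege1.
by lra.
Qed.
End Lorentz.

(** * Bounded trajectories *)

Section Trajectory.
Context {R : realType} (rho V : 'rV[R]_3 -> R) (eps b c : R)
  (r u w z : R -> 'rV[R]_3).
Hypotheses (rho_charge : ef_charge rho != 0) (VCk : Ck 3 V) (eps0 : 0 < eps)
  (b1 : b < 1).
Hypotheses (dr : forall t : R, 0 < t -> is_derive t 1 r (u t))
  (du : forall t : R, 0 < t -> is_derive t 1 u (w t))
  (dw : forall t : R, 0 < t -> is_derive t 1 w (z t)).
Hypothesis motion : forall t : R, 0 < t -> ef_mass rho (u t) (w t) =
  - grad V (r t) + eps *: amat rho (u t) (z t) + eps *: bvec rho (u t) (w t).
Hypotheses (ub : forall t : R, 0 < t -> ef_enorm (u t) <= b)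
  (wc : forall t : R, 0 < t -> ef_enorm (w t) <= c).

Implicit Types t : R.

Let k := radiation_coef rho.
Let x t := gamma_sq (u t).
Let d t := ef_dot (u t) (w t).
Let S t := k * d t * (x t ^+ 2 + 4 * x t ^+ 3 * ef_dot (u t) (u t)).
Let H t := kinetic rho (u t) + V (r t) - eps * S t.

Let k0 : 0 < k. Proof. exact: radiation_coef_gt0. Qed.
Let pos t : 1 <= t -> 0 < t :> R. Proof. exact: lt_le_trans. Qed.

Lemma u_lt1 t : 0 < t -> ef_dot (u t) (u t) < 1.
Proof. by move=> /ub ut; rewrite -enorm_lt1 (le_lt_trans ut). Qed.

Lemma is_derive_along (s : seq 'I_3) t : (size s < 3)%N -> 0 < t ->
  is_derive t 1 (fun t => iterpd s V (r t))
    (\sum_(i < 3) iterpd (i :: s) V (r t) * u t 0 i).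
Proof.
move=> s3 t0; apply: (is_derive_gradient _ _ _ _ _ _ (dr _ t0)).
- by move=> i q; exact: (VCk s (ltnW s3)).2.
- by move=> i; exact: (VCk (i :: s) s3).1.
Qed.

Lemma is_derive_energy t : 0 < t ->
  is_derive t 1 H (- (eps * k * (x t ^+ 3 * ef_dot (w t) (w t) + 6 * x t ^+ 4 * d t ^+ 2))).
Proof.
move=> t0; have u1 := u_lt1 _ t0.
have dx := is_derive_gamma_sq _ _ _ (du _ t0) u1.
have dq := is_derive_dot _ _ _ _ _ (du _ t0) (du _ t0).
have dd := is_derive_dot _ _ _ _ _ (du _ t0) (dw _ t0).
have dV := is_derive_along [::] t isT t0.
have dK : is_derive t 1 (fun s => kinetic rho (u s))
    (ef_dot (u t) (ef_mass rho (u t) (w t))).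
  apply: (is_derive_kinetic _ _ _ _ b (du _ t0) b1).
  near=> s; apply: ub; near: s; exact: lt_nbhsr.
rewrite motion// in dK.
have xq : x t * ef_dot (u t) (u t) = x t - 1.
  rewrite /x /gamma_sq; field.
  by rewrite gt_eqF ?subr_gt0.
rewrite /H /S /x /d; pointwise_derive.
rewrite -/(x t) -/(d t).
have -> : ef_dot (u t)
    (- grad V (r t) + eps *: amat rho (u t) (z t) + eps *: bvec rho (u t) (w t)) =
   - (\sum_(i < 3) iterpd [:: i] V (r t) * u t 0 i)
   + eps * ef_dot (u t) (amat rho (u t) (z t))
   + eps * ef_dot (u t) (bvec rho (u t) (w t)).
  have E (A B C v : 'rV[R]_3) : ef_dot v (- A + eps *: B + eps *: C) =
      - ef_dot A v + eps * ef_dot v B + eps * ef_dot v C.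
    by rewrite !ef_dotE !mxE; ring.
  by rewrite E; congr (- _ + _ + _); apply: eq_bigr => i _; rewrite mxE.
have -> : ef_dot (u t) (amat rho (u t) (z t)) =
   k * (x t ^+ 2 + 4 * x t ^+ 3 * ef_dot (u t) (u t)) * ef_dot (u t) (z t).
  by rewrite ef_dotE !amatE// -/(x t) -/k !ef_dotE; ring.
have -> : ef_dot (u t) (bvec rho (u t) (w t)) =
   3 * k * (2 * x t ^+ 3 * d t ^+ 2 + x t ^+ 3 * ef_dot (w t) (w t) * ef_dot (u t) (u t)
     + 6 * x t ^+ 4 * d t ^+ 2 * ef_dot (u t) (u t)).
  by rewrite ef_dotE !bvecE// -/(x t) -/k /d !ef_dotE; ring.
rewrite (ef_dotC (w t) (u t)) -/(d t) [\sum_(i < 3) iterpd _ V _ * _]/=.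
have x0 : x t != 0 by rewrite gt_eqF// (lt_le_trans _ (gamma_sq_ge1 _ u1)).
have -> : ef_dot (u t) (u t) = 1 - (x t)^-1 by rewrite -[LHS](mulKf x0) xq; field.
by field.
Unshelve. all: by end_near. Qed.

Hypothesis Vcond : condU V \/ condU' V.

Lemma V_lower_bound : exists m, forall q, m <= V q.
Proof.
have [[[m Vm] _]|V'] := Vcond; first by exists m.
have [R0 VR0] := V' 0.
have [B VB] := bounded_on_enorm_ball V R0 (VCk [::] isT).1.
exists (- `|B|) => q; have [qR|/VR0 q0] := leP (ef_enorm q) R0.
  by have := VB _ qR; rewrite ler_norml => /andP[+ _]; apply: le_trans; rewrite lerN2 ler_norm.
by rewrite (le_trans _ (ltW q0))// oppr_le0.
Qed.

Let bu i : bdd (fun t => u t 0 i).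
Proof.
by exists b => t /pos t0; rewrite (le_trans (coord_le_enorm _ i))// ub.
Qed.

Let bw i : bdd (fun t => w t 0 i).
Proof.
by exists c => t /pos t0; rewrite (le_trans (coord_le_enorm _ i))// wc.
Qed.

Lemma bdd_dot (f g : R -> 'rV[R]_3) : (forall i, bdd (fun t => f t 0 i)) ->
  (forall i, bdd (fun t => g t 0 i)) -> bdd (fun t => ef_dot (f t) (g t)).
Proof.
move=> fb gb; under eq_fun do rewrite ef_dotE.
by do 2?apply: bddD; apply: bddM.
Qed.

Lemma vanishing_dot (f g : R -> 'rV[R]_3) : (forall i, bdd (fun t => f t 0 i)) ->
  (forall i, vanishing (fun t => g t 0 i)) -> vanishing (fun t => ef_dot (f t) (g t)).
Proof.
move=> fb gb; under eq_fun do rewrite ef_dotE.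
by do 2?apply: vanishingD; apply: bdd_vanishingM.
Qed.

Let bx : bdd x.
Proof.
exists (1 - b ^+ 2)^-1 => t /pos t0.
by rewrite ger0_norm ?(le_trans _ (gamma_sq_ge1 _ (u_lt1 _ t0)))// gamma_sq_le ?ub.
Qed.

Let bq : bdd (fun t => ef_dot (u t) (u t)). Proof. exact: bdd_dot. Qed.
Let bd : bdd d. Proof. exact: bdd_dot. Qed.
Let bww : bdd (fun t => ef_dot (w t) (w t)). Proof. exact: bdd_dot. Qed.

Let bgamma : bdd (fun t => ef_gamma (u t)).
Proof.
apply: bdd_sqr; apply: (bdd_le x) => // t /pos t0.
by rewrite (gammaXM _ 1 (u_lt1 _ t0)).
Qed.

Let bphi : bdd (fun t => ef_phi (ef_enorm (u t))).
Proof.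
exists ((1 - b ^+ 2) ^- 2) => t /pos t0.
have /andP[p0 p1] : 0 <= ef_phi (ef_enorm (u t)) <= (1 - b ^+ 2) ^- 2.
  by apply: ef_phi_bounds; rewrite ?enorm_ge0 ?ub.
by rewrite ger0_norm.
Qed.

Let bmf i j : bdd (fun t => mf_coef (u t) * u t 0 i * u t 0 j).
Proof.
by exists (4 * (1 - b ^+ 2) ^- 2) => t /pos t0; apply: mf_coef_bound; rewrite ?ub.
Qed.

Let mass_coordE t i : ef_mass rho (u t) (w t) 0 i =
  ef_gamma (u t) * w t 0 i + ef_gamma (u t) ^+ 3 * u t 0 i * d t
  + 3 * m_e rho * (ef_phi (ef_enorm (u t)) * w t 0 i
     + (mf_coef (u t) * u t 0 0 * u t 0 i * w t 0 0
        + mf_coef (u t) * u t 0 1 * u t 0 i * w t 0 1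
        + mf_coef (u t) * u t 0 2 * u t 0 i * w t 0 2)).
Proof. by rewrite mass_coord /d ef_dotE; ring. Qed.

Let bmass i : bdd (fun t => ef_mass rho (u t) (w t) 0 i).
Proof.
under eq_fun do rewrite mass_coordE.
have wi := bw i; have w0 := bw 0; have w1 := bw 1; have w2 := bw 2.
have m0 := bmf 0 i; have m1 := bmf 1 i; have m2 := bmf 2 i; have ui := bu i.
by bdd_rules.
Qed.

Let bKS : bdd (fun t => kinetic rho (u t) - eps * S t).
Proof. by rewrite /kinetic /S; bdd_rules. Qed.

Let bvec_coordE t i : 0 < t -> bvec rho (u t) (w t) 0 i =
  3 * k * (2 * x t ^+ 3 * d t * w t 0 i + x t ^+ 3 * u t 0 i * ef_dot (w t) (w t)
    + 6 * x t ^+ 4 * u t 0 i * d t * d t).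
Proof. by move=> t0; rewrite bvecE ?u_lt1// -/(x t) -/(d t) -/k; ring. Qed.

Lemma energy_nonincreasing s t : 1 <= s -> s <= t -> H t <= H s.
Proof.
move=> s1; rewrite le_eqVlt => /predU1P[->//|st]; rewrite -subr_le0.
have [y /andP[sy _]|y /andP[sy _] ->] := MVT_derive H
   (fun t => - (eps * k * (x t ^+ 3 * ef_dot (w t) (w t) + 6 * x t ^+ 4 * d t ^+ 2))) _ _ st.
  by apply: is_derive_energy; rewrite pos// (le_trans s1).
rewrite mulNr oppr_le0 mulr_ge0 ?subr_ge0 ?(ltW st)//.
have x0 : 0 <= x y by rewrite (le_trans _ (gamma_sq_ge1 _ (u_lt1 _ _)))// pos// (le_trans s1).
apply: mulr_ge0; first by rewrite mulr_ge0// ltW.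
by apply: addr_ge0; apply: mulr_ge0; rewrite ?ef_dot_ge0 ?sqr_ge0 ?mulr_ge0// exprn_ge0.
Qed.

Lemma energy_cvg : cvg (H t @[t --> +oo]).
Proof.
have [m Vm] := V_lower_bound; have [M KSM] := bKS.
apply: (nonincreasing_cvg H (m - M) energy_nonincreasing) => t t1.
have := KSM _ t1; rewrite ler_norml => /andP[+ _]; have := Vm (r t); rewrite /H.
by lra.
Qed.

Lemma bdd_iterpd (s : seq 'I_3) : (size s <= 3)%N -> bdd (fun t => iterpd s V (r t)).
Proof.
move=> s3; have [[_ [M VM]]|V'] := Vcond; first by exists M => t _; exact: VM.
have [M KSM] := bKS; have [R0 VR0] := V' (H 1 + M).
have [B VB] := bounded_on_enorm_ball (iterpd s V) R0 (VCk s s3).1.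
exists B => t t1; apply: VB; rewrite leNgt; apply/negP => /VR0.
have := KSM _ t1; have := energy_nonincreasing _ _ (lexx _) t1.
by rewrite ler_norml {1}/H => A /andP[B1 B2]; lra.
Qed.

Let amat_motion t i : 0 < t -> amat rho (u t) (z t) 0 i =
  eps^-1 * (pd i V (r t) + (ef_mass rho (u t) (w t) 0 i - eps * bvec rho (u t) (w t) 0 i)).
Proof.
move=> t0; rewrite motion//.
have E (A B C : 'rV[R]_3) : (- A + eps *: B + eps *: C) 0 i =
    - A 0 i + eps * B 0 i + eps * C 0 i by rewrite !mxE.
have -> : pd i V (r t) = grad V (r t) 0 i by rewrite mxE.
by rewrite E; field; rewrite gt_eqF.
Qed.

Let bbvec i : bdd (fun t => bvec rho (u t) (w t) 0 i).
Proof.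
have ui := bu i; have wi := bw i.
apply: (bdd_le (fun t => 3 * k * (2 * x t ^+ 3 * d t * w t 0 i
    + x t ^+ 3 * u t 0 i * ef_dot (w t) (w t) + 6 * x t ^+ 4 * u t 0 i * d t * d t))).
  by move=> t /pos t0; rewrite bvec_coordE.
by bdd_rules.
Qed.

Let coord_sqr_le (v : 'rV[R]_3) i : v 0 i ^+ 2 <= ef_dot v v.
Proof.
rewrite -enorm_sqr -(real_normK (num_real (v 0 i))).
by rewrite lerXn2r ?nnegrE ?enorm_ge0 ?coord_le_enorm.
Qed.

Let z_le_amat t i : 1 <= t ->
  `|z t 0 i ^+ 2| <=
    `|k ^- 2 * ef_dot (amat rho (u t) (z t)) (amat rho (u t) (z t))|.
Proof.
move=> /pos t0; have := amat_coercive _ _ (z t) rho_charge (u_lt1 _ t0).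
rewrite -/k => E; rewrite [leLHS]ger0_norm ?sqr_ge0//.
apply: le_trans (coord_sqr_le _ i) _; apply: le_trans (ler_norm _).
by rewrite mulrC ler_pdivlMr ?exprn_gt0// mulrC.
Qed.

Let bz i : bdd (fun t => z t 0 i).
Proof.
apply: bdd_sqr; apply: (bdd_le _ (z_le_amat ^~ i)); apply: bddM; first exact: bdd_cst.
have ba j : bdd (fun t => amat rho (u t) (z t) 0 j).
  apply: (bdd_le (fun t => eps^-1 * (pd j V (r t)
     + (ef_mass rho (u t) (w t) 0 j - eps * bvec rho (u t) (w t) 0 j)))).
    by move=> t /pos t0; rewrite amat_motion.
  have bV := bdd_iterpd [:: j] isT; have bm := bmass j; have bb := bbvec j.
  by bdd_rules.
exact: bdd_dot.
Qed.

Lemma w_vanishing i : vanishing (fun t => w t 0 i).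
Proof.
apply/vanishingP => e e0.
have ek : 0 < eps * k by rewrite mulr_gt0.
have ee : 0 < eps * k * e ^+ 2 by rewrite mulr_gt0// exprn_gt0.
pose G t := eps * k * ef_dot (w t) (w t).
pose dG t := eps * k * (2 * ef_dot (w t) (z t)).
pose dP t := eps * k * (x t ^+ 3 * ef_dot (w t) (w t) + 6 * x t ^+ 4 * d t ^+ 2).
have bwz : bdd (fun t => ef_dot (w t) (z t)) by exact: bdd_dot.
have : \forall t \near +oo, G t <= eps * k * e ^+ 2; last first.
  apply: filterS => t; rewrite /G ler_pM2l// => Gt.
  rewrite -ler_sqr ?nnegrE ?(ltW e0)// real_normK ?num_real//.
  exact: le_trans (coord_sqr_le _ i) Gt.
apply: (barbalat (fun t => - H t) G dP dG _ _ _ _ _ _ ee) => [t t1|t t1|||].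
- rewrite -[dP t]opprK; apply: is_derive_oppf; exact/is_derive_energy/pos.
- have dww := is_derive_dot _ _ _ _ _ (dw _ (pos _ t1)) (dw _ (pos _ t1)).
  by rewrite /G /dG; pointwise_derive; rewrite (ef_dotC (z t)); ring.
- by rewrite /dG; bdd_rules.
- by apply: is_cvgN; exact: energy_cvg.
- move=> dl dl0; near=> t.
  have t1 : 1 <= t by near: t; exact: nbhs_pinfty_ge (num_real _).
  rewrite lerBlDr; apply: ler_wpDr; first exact: ltW.
  rewrite /G /dP ler_pM2l//; apply: ler_wpDr.
    apply: mulr_ge0; last exact: sqr_ge0.
    by rewrite mulr_ge0// exprn_ge0// (le_trans _ (gamma_sq_ge1 _ (u_lt1 _ (pos _ t1)))).
  by rewrite ler_peMl ?ef_dot_ge0// exprn_ege1// gamma_sq_ge1// u_lt1// pos.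
Unshelve. all: by end_near. Qed.

Let vd : vanishing d.
Proof. by apply: vanishing_dot => // i; exact: w_vanishing. Qed.

Let vww : vanishing (fun t => ef_dot (w t) (w t)).
Proof. by apply: vanishing_dot => // i; exact: w_vanishing. Qed.

Let vmass i : vanishing (fun t => ef_mass rho (u t) (w t) 0 i).
Proof.
under eq_fun do rewrite mass_coordE.
have wi := w_vanishing i; have w0 := w_vanishing 0; have w1 := w_vanishing 1.
have w2 := w_vanishing 2.
have m0 := bmf 0 i; have m1 := bmf 1 i; have m2 := bmf 2 i; have ui := bu i.
by vanishing_rules.
Qed.

Let vbvec i : vanishing (fun t => bvec rho (u t) (w t) 0 i).
Proof.
have ui := bu i; have wi := w_vanishing i.
apply: (vanishing_eq _ (fun t => 3 * k * (2 * x t ^+ 3 * d t * w t 0 i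
    + x t ^+ 3 * u t 0 i * ef_dot (w t) (w t) + 6 * x t ^+ 4 * u t 0 i * d t * d t))).
  by move=> t /pos t0; rewrite bvec_coordE.
by vanishing_rules.
Qed.

Lemma grad_vanishing i : vanishing (fun t => pd i V (r t)).
Proof.
pose P t := eps * (k * (x t ^+ 2 * w t 0 i + 4 * x t ^+ 3 * d t * u t 0 i)).
pose E t := ef_mass rho (u t) (w t) 0 i - eps * bvec rho (u t) (w t) 0 i
  + eps * k * (4 * x t ^+ 3 * d t * w t 0 i + 24 * x t ^+ 4 * d t * u t 0 i * d t
     + 4 * x t ^+ 3 * u t 0 i * ef_dot (w t) (w t) + 4 * x t ^+ 3 * d t * w t 0 i).
have ui := bu i; have vi := w_vanishing i; have vm := vmass i; have vb := vbvec i.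
have vP : vanishing P by rewrite /P; vanishing_rules.
have vE : vanishing E by rewrite /E; vanishing_rules.
have dP t : 0 < t -> is_derive t 1 P (pd i V (r t) + E t).
  move=> t0; have u1 := u_lt1 _ t0.
  have dx := is_derive_gamma_sq _ _ _ (du _ t0) u1.
  have dd := is_derive_dot _ _ _ _ _ (du _ t0) (dw _ t0).
  have dui := is_derive_coord _ _ _ i (du _ t0).
  have dwi := is_derive_coord _ _ _ i (dw _ t0).
  have := amat_motion _ i t0; rewrite amatE// -/k -/(x t) => am.
  have {am} -> : pd i V (r t) =
     eps * (k * (x t ^+ 2 * z t 0 i + 4 * x t ^+ 3 * ef_dot (u t) (z t) * u t 0 i))
     - (ef_mass rho (u t) (w t) 0 i - eps * bvec rho (u t) (w t) 0 i).
    by rewrite am; field; rewrite gt_eqF.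
  rewrite /P /E /x /d; pointwise_derive.
  by rewrite -/(x t) -/(d t); ring.
pose G t := pd i V (r t).
pose dG t := \sum_(j < 3) iterpd [:: j; i] V (r t) * u t 0 j.
have dG1 t : 0 < t -> is_derive t 1 G (dG t) by move=> t0; exact: (is_derive_along [:: i]).
have bdG : bdd dG.
  rewrite /dG; under eq_fun do rewrite sum3.
  do 2?apply: bddD; apply: bddM => //; exact: bdd_iterpd.
apply/vanishingP => e e0.
have le : \forall t \near +oo, G t <= e.
  apply: (barbalat P G (fun t => pd i V (r t) + E t) dG _ _ bdG _ _ _ e0).
  - by move=> t /pos; exact: dP.
  - by move=> t /pos; exact: dG1.
  - exact: cvgP vP.
  - move=> dl /(vanishingP.1 vE); apply: filterS => t.
    by rewrite ler_norml => /andP[+ _]; rewrite lerD2l.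
have ge : \forall t \near +oo, - G t <= e.
  apply: (barbalat (fun t => - P t) (fun t => - G t) (fun t => - (pd i V (r t) + E t))
    (fun t => - dG t) _ _ (bddN bdG) _ _ _ e0).
  - by move=> t /pos t0; apply: is_derive_oppf; exact: dP.
  - by move=> t /pos t0; apply: is_derive_oppf; exact: dG1.
  - by apply: is_cvgN; exact: cvgP vP.
  - move=> dl /(vanishingP.1 vE); apply: filterS => t.
    by rewrite ler_norml => /andP[_ +]; rewrite opprD lerD2l lerN2.
near=> t; rewrite ler_norml lerNl; apply/andP; split; near: t; [exact: ge | exact: le].
Unshelve. all: by end_near. Qed.

Lemma z_vanishing i : vanishing (fun t => z t 0 i).
Proof.
apply: vanishing_sqr; apply: (vanishing_le _ (z_le_amat ^~ i)).
have va j : vanishing (fun t => amat rho (u t) (z t) 0 j).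
  apply: (vanishing_eq _ (fun t => eps^-1 * (pd j V (r t)
     + (ef_mass rho (u t) (w t) 0 j - eps * bvec rho (u t) (w t) 0 j)))).
    by move=> t /pos t0; rewrite amat_motion.
  have vV := grad_vanishing j; have vm := vmass j; have vb := vbvec j.
  by vanishing_rules.
apply: bdd_vanishingM; first exact: bdd_cst.
have E : (fun t => ef_dot (amat rho (u t) (z t)) (amat rho (u t) (z t))) =
    (fun t => amat rho (u t) (z t) 0 0 * amat rho (u t) (z t) 0 0
      + amat rho (u t) (z t) 0 1 * amat rho (u t) (z t) 0 1
      + amat rho (u t) (z t) 0 2 * amat rho (u t) (z t) 0 2).
  by apply/funext => t; rewrite ef_dotE.
have vaa j : vanishing (fun t => amat rho (u t) (z t) 0 j * amat rho (u t) (z t) 0 j).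
  have := cvgM (va j) (va j); rewrite mulr0; exact.
by rewrite E; do 2?apply: vanishingD.
Qed.
End Trajectory.

Lemma vanishing_row {R : realType} (f : R -> 'rV[R]_3) :
  (forall i, vanishing (fun t => f t 0 i)) ->
  f t @[t --> +oo] --> (0 : 'rV[R]_3).
Proof.
move=> f0; apply/cvgr0Pnorm_le => e e0; near=> t.
apply: norm_rowP; first exact: ltW.
by near: t; apply: filter_forall => i; exact: (vanishingP.1 (f0 i)).
Unshelve. all: by end_near. Qed.

Theorem theorem4p3 (R : realType) (rho : 'rV[R]_3 -> R) (V : 'rV[R]_3 -> R)
  (eps : R) (r u : R -> 'rV[R]_3) (ubar c : R) :
  Cinf rho -> compact_support rho -> radial rho -> ef_charge rho != 0 ->
  Ck 3 V -> condU V \/ condU' V ->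
  0 < eps ->
  (forall t, 0 < t ->
     [/\ derivable r t 1, derivable u t 1, derivable (derive1 u) t 1,
         derive1 r t = u t &
         ef_mass rho (u t) (derive1 u t) =
           - grad V (r t) + eps *: amat rho (u t) (derive1 (derive1 u) t)
           + eps *: bvec rho (u t) (derive1 u t)]) ->
  ubar < 1 ->
  (forall t, 0 < t -> ef_enorm (u t) <= ubar) ->
  (forall t, 0 < t -> ef_enorm (derive1 u t) <= c) ->
  [/\ derive1 u t @[t --> +oo] --> (0 : 'rV[R]_3),
      derive1 (derive1 u) t @[t --> +oo] --> 0 &
      grad V (r t) @[t --> +oo] --> (0 : 'rV[R]_3)].
Proof.
move=> _ _ _ rho_charge VCk Vcond eps0 sol b1 ub wc.
have dr (t : R) : 0 < t -> is_derive t 1 r (u t).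
  by move=> /sol[rt _ _ <- _]; rewrite derive1E; exact: derivableP.
have du (t : R) : 0 < t -> is_derive t 1 u (derive1 u t).
  by move=> /sol[_ ut _ _ _]; rewrite derive1E; exact: derivableP.
have dw (t : R) : 0 < t -> is_derive t 1 (derive1 u) (derive1 (derive1 u) t).
  by move=> /sol[_ _ wt _ _]; rewrite [derive1 (derive1 u) t]derive1E; exact: derivableP.
have motion (t : R) : 0 < t -> ef_mass rho (u t) (derive1 u t) =
    - grad V (r t) + eps *: amat rho (u t) (derive1 (derive1 u) t)
    + eps *: bvec rho (u t) (derive1 u t).
  by move=> /sol[].
split; apply: vanishing_row => i.
- exact: (w_vanishing _ _ _ _ _ _ _ _ _
    rho_charge VCk eps0 b1 dr du dw motion ub wc Vcond).
- exact: (z_vanishing _ _ _ _ _ _ _ _ _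
    rho_charge VCk eps0 b1 dr du dw motion ub wc Vcond).
- under eq_fun do rewrite mxE.
  exact: (grad_vanishing _ _ _ _ _ _ _ _ _
    rho_charge VCk eps0 b1 dr du dw motion ub wc Vcond).
Qed.
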